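(* Let $(M,g)$ be a pseudo-Riemannian Einstein manifold of dimension $n\ge3$ with scalar curvature $\mathrm{Sc}\ne0$, and let $k\in\mathbb{Z}_{>0}$. The null space $\mathcal{N}(P_k)$ of the GJMS operator $P_k$, as an operator on smooth real valued functions on $M$, has a direct sum decomposition $$\mathcal{N}(P_k)=\bigoplus_{i=1}^{k}\mathcal{N}_i(Y),$$ where $\mathcal{N}_i(Y)$ is the eigenspace for $Y$ with eigenvalue $-b_i\mathrm{Sc}$, $b_i=\frac{i(1-i)}{n(n-1)}$ (that is, the space of smooth real valued functions $u$ with $Yu=-b_i\mathrm{Sc}\,u$).
   Context: Einstein means that the Ricci curvature is proportional to the metric; the scalar curvature $\mathrm{Sc}$ (metric trace of Ricci) is then constant. $\Delta=\delta d=\nabla^*\nabla$ is the positive energy Laplacian on functions ($\delta$ the formal adjoint of the exterior derivative $d$). The conformal Laplacian is $Y=\Delta+\frac{n(n-2)}{4n(n-1)}\mathrm{Sc}$. On an Einstein manifold, for any $k\in\mathbb{Z}_{>0}$, the (order $2k$) GJMS operator means $$P_k=\prod_{i=1}^{k}(\Delta+c_i\mathrm{Sc}),\qquad c_i=\frac{(n+2i-2)(n-2i)}{4n(n-1)},$$ equivalently $P_k=\prod_{i=1}^{k}(Y+b_i\mathrm{Sc})$. *)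

(* Defs.v *)
From mathcomp Require Export all_boot all_order all_algebra.
From mathcomp Require Export all_classical all_reals all_analysis.
Export Order.TTheory GRing.Theory Num.Theory numFieldNormedType.Exports.

Set Implicit Arguments.
Unset Strict Implicit.
Unset Printing Implicit Defensive.

Local Open Scope classical_set_scope.
Local Open Scope ring_scope.

Definition partial (R : realType) (n : nat) (i : 'I_n) (f : 'rV[R]_n -> R)
    : 'rV[R]_n -> R :=
  fun y => 'D_('e_i) f y.

(* [U] is meant to be open; [f] is unconstrained outside [U] *)
Fixpoint Ck_on (R : realType) (n : nat) (k : nat) (U : set 'rV[R]_n)
    (f : 'rV[R]_n -> R) : Prop :=
  (forall y, U y -> {for y, continuous f}) /\
  match k with
  | 0 => True
  | k'.+1 => forall i : 'I_n,
      (forall y, U y -> derivable f y 'e_i) /\ Ck_on k' U (partial i f)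
  end.

Definition smooth_on (R : realType) (n : nat) (U : set 'rV[R]_n)
    (f : 'rV[R]_n -> R) : Prop :=
  forall k, Ck_on k U f.

Record chart (R : realType) (n : nat) (T : topologicalType) := Chart {
  chart_dom : set T;
  chart_img : set 'rV[R]_n;
  chart_map : T -> 'rV[R]_n;
  chart_inv : 'rV[R]_n -> T;
  chart_dom_open : open chart_dom;
  chart_img_open : open chart_img;
  chart_map_img : forall x, chart_dom x -> chart_img (chart_map x);
  chart_inv_dom : forall y, chart_img y -> chart_dom (chart_inv y);
  chart_mapK : forall x, chart_dom x -> chart_inv (chart_map x) = x;
  chart_invK : forall y, chart_img y -> chart_map (chart_inv y) = y;
  chart_map_cont : forall x, chart_dom x -> {for x, continuous chart_map};
  chart_inv_cont : forall y, chart_img y -> {for y, continuous chart_inv}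
}.

Definition transition (R : realType) (n : nat) (T : topologicalType)
    (a b : chart R n T) : 'rV[R]_n -> 'rV[R]_n :=
  chart_map b \o chart_inv a.

Definition overlap (R : realType) (n : nat) (T : topologicalType)
    (a b : chart R n T) : set 'rV[R]_n :=
  chart_img a `&` chart_inv a @^-1` chart_dom b.

(* No connectedness and no maximality of the atlas is required; an atlas and the
   maximal atlas it generates have the same smooth functions and metrics. *)
Record manifold (R : realType) (n : nat) := Manifold {
  mfd_space :> topologicalType;
  mfd_hausdorff : hausdorff_space mfd_space;
  mfd_second_countable : @second_countable mfd_space;
  atlas : Type;
  chart_of : atlas -> chart R n mfd_space;
  atlas_cover : forall x, exists a, chart_dom (chart_of a) x;
  atlas_smooth : forall (a b : atlas) (j : 'I_n),
    smooth_on (overlap (chart_of a) (chart_of b))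
      (fun y => transition (chart_of a) (chart_of b) y ord0 j)
}.

Coercion chart_of : atlas >-> chart.

(* A chart around [x]; the tensorial quantities evaluated in it below do not
   depend on the choice. *)
Definition chart_at (R : realType) (n : nat) (M : manifold R n) (x : M)
    : atlas M :=
  sval (cid (atlas_cover x)).

Definition smooth (R : realType) (n : nat) (M : manifold R n) (u : M -> R)
    : Prop :=
  forall a : atlas M, smooth_on (chart_img a) (u \o chart_inv a).

(* Pseudo-Riemannian metrics.  [metric_mx g a y] is the matrix (g_ij) in the
   chart [a] at the point with coordinates [y].  With the row-vector convention
   of ['J], the entry (i, j) of the Jacobian is the derivative of the j-th
   component in the direction i.  No signature is prescribed. *)
Record pseudo_metric (R : realType) (n : nat) (M : manifold R n) :=
PseudoMetric {
  metric_mx :> atlas M -> 'rV[R]_n -> 'M[R]_n;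
  metric_smooth : forall (a : atlas M) (i j : 'I_n),
    smooth_on (chart_img a) (fun y => metric_mx a y i j);
  metric_sym : forall (a : atlas M) y,
    chart_img a y -> (metric_mx a y)^T = metric_mx a y;
  metric_nondegenerate : forall (a : atlas M) y,
    chart_img a y -> metric_mx a y \in unitmx;
  metric_change : forall (a b : atlas M) y, overlap a b y ->
    metric_mx a y =
      'J (transition a b) y *m metric_mx b (transition a b y)
        *m ('J (transition a b) y)^T
}.

(* In the coordinate formulas below, [g] is the matrix function of the metric
   in one fixed chart. *)

Definition christoffel (R : realType) (n : nat) (g : 'rV[R]_n -> 'M[R]_n)
    (k i j : 'I_n) : 'rV[R]_n -> R :=
  fun y => 2^-1 * \sum_(l < n) invmx (g y) k l *
    (partial i (fun z => g z j l) y + partial j (fun z => g z i l) y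
     - partial l (fun z => g z i j) y).

(* The component R^l_{kij}, where R(e_i, e_j) e_k = R^l_{kij} e_l and
   R(X, Y) = [nabla_X, nabla_Y] - nabla_[X, Y] *)
Definition riemann (R : realType) (n : nat) (g : 'rV[R]_n -> 'M[R]_n)
    (l k i j : 'I_n) : 'rV[R]_n -> R :=
  fun y => partial i (christoffel g l j k) y - partial j (christoffel g l i k) y
    + \sum_(m < n) (christoffel g l i m y * christoffel g m j k y
                    - christoffel g l j m y * christoffel g m i k y).

(* Ric(Y, Z) is the trace of X |-> R(X, Y) Z, so that round spheres have
   positive Ricci curvature *)
Definition ricci (R : realType) (n : nat) (g : 'rV[R]_n -> 'M[R]_n)
    (y : 'rV[R]_n) : 'M[R]_n :=
  \matrix_(j, k) \sum_(i < n) riemann g i k i j y.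

Definition scalar_curvature (R : realType) (n : nat)
    (g : 'rV[R]_n -> 'M[R]_n) (y : 'rV[R]_n) : R :=
  \sum_(i < n) \sum_(j < n) invmx (g y) i j * ricci g y i j.

Definition volume_density (R : realType) (n : nat) (g : 'rV[R]_n -> 'M[R]_n)
    (y : 'rV[R]_n) : R :=
  Num.sqrt `|\det (g y)|.

Definition exterior_d (R : realType) (n : nat) (f : 'rV[R]_n -> R)
    : 'rV[R]_n -> 'rV[R]_n :=
  fun y => \row_j partial j f y.

(* The formal adjoint of d for the pairings of functions, \int f h dV, and of
   1-forms, \int g^{ij} eta_i omega_j dV, where dV = |det g|^{1/2} dy:
   integrating \int g^{ij} (d_i f) omega_j dV by parts gives
   delta omega = - |det g|^{-1/2} d_i (|det g|^{1/2} g^{ij} omega_j),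
   which is also - nabla^j omega_j. *)
Definition codifferential (R : realType) (n : nat)
    (g : 'rV[R]_n -> 'M[R]_n) (omega : 'rV[R]_n -> 'rV[R]_n)
    : 'rV[R]_n -> R :=
  fun y => - (volume_density g y)^-1 *
    \sum_(i < n) partial i
      (fun z => volume_density g z *
                \sum_(j < n) invmx (g z) i j * omega z ord0 j) y.

Definition local_laplacian (R : realType) (n : nat)
    (g : 'rV[R]_n -> 'M[R]_n) (f : 'rV[R]_n -> R) : 'rV[R]_n -> R :=
  codifferential g (exterior_d f).

Definition scal (R : realType) (n : nat) (M : manifold R n)
    (g : pseudo_metric M) (x : M) : R :=
  let a := chart_at x in scalar_curvature (g a) (chart_map a x).

(* The factor is a constant, not a function, as [M] may be disconnected. *)
Definition einstein (R : realType) (n : nat) (M : manifold R n)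
    (g : pseudo_metric M) : Prop :=
  exists lambda : R, forall (a : atlas M) y,
    chart_img a y -> ricci (g a) y = lambda *: g a y.

Definition laplacian (R : realType) (n : nat) (M : manifold R n)
    (g : pseudo_metric M) (u : M -> R) : M -> R :=
  fun x => let a := chart_at x in
    local_laplacian (g a) (u \o chart_inv a) (chart_map a x).

Definition conformal_laplacian (R : realType) (n : nat) (M : manifold R n)
    (g : pseudo_metric M) (u : M -> R) : M -> R :=
  fun x => laplacian g u x
    + n%:R * (n%:R - 2) / (4 * n%:R * (n%:R - 1)) * scal g x * u x.

Definition c_coef (R : realType) (n i : nat) : R :=
  (n%:R + 2 * i%:R - 2) * (n%:R - 2 * i%:R) / (4 * n%:R * (n%:R - 1)).

Definition b_coef (R : realType) (n i : nat) : R :=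
  i%:R * (1 - i%:R) / (n%:R * (n%:R - 1)).

Definition gjms_factor (R : realType) (n : nat) (M : manifold R n)
    (g : pseudo_metric M) (i : nat) (u : M -> R) : M -> R :=
  fun x => laplacian g u x + c_coef R n i * scal g x * u x.

(* The product is composition of operators, with the factor i = 1 outermost; on
   an Einstein manifold the factors commute. *)
Definition gjms (R : realType) (n : nat) (M : manifold R n)
    (g : pseudo_metric M) (k : nat) : (M -> R) -> (M -> R) :=
  \big[(fun A B => A \o B)/id]_(1 <= i < k.+1) gjms_factor g i.

Definition null_space (R : realType) (n : nat) (M : manifold R n)
    (A : (M -> R) -> (M -> R)) : set (M -> R) :=
  [set u | smooth u /\ forall x, A u x = 0].

Definition Y_eigenspace (R : realType) (n : nat) (M : manifold R n)
    (g : pseudo_metric M) (i : nat) : set (M -> R) :=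
  [set u | smooth u /\
    forall x, conformal_laplacian g u x = - b_coef R n i * scal g x * u x].

Definition linear_subspace (R : realType) (V : lmodType R) (W : set V)
    : Prop :=
  W 0 /\ forall (a : R) u v, W u -> W v -> W (a *: u + v).

Definition internal_direct_sum (R : realType) (V : lmodType R) (I : finType)
    (W : set V) (Ws : I -> set V) : Prop :=
  [/\ linear_subspace W,
      forall i, linear_subspace (Ws i),
      forall w, W w <->
        exists2 v : I -> V, (forall i, Ws i (v i)) & w = \sum_i v i
    & forall v : I -> V, (forall i, Ws i (v i)) -> \sum_i v i = 0 ->
        forall i, v i = 0].

(* Main.v *)
Require Import Defs.
From mathcomp Require Import perm ring lra.

(** On an Einstein manifold with Ric = lambda g the scalar curvature is the
    constant n lambda, so every factor of P_k has the form Delta + c_i Sc with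
    c_i Sc a number.  Since
      (n + 2i - 2)(n - 2i) = n(n - 2) + 4i(1 - i),
    c_i Sc is the zeroth-order constant of Y plus b_i Sc: the eigenspace of Y
    for -b_i Sc is the eigenspace of Delta for -c_i Sc.  For i >= 1 the numbers
    c_i are pairwise distinct, and Sc is nonzero, so P_k is a product of
    operators Delta + a_i with distinct scalars a_i.  The decomposition of its
    kernel is then linear algebra, valid for any linear endomorphism of a
    vector space ([shifted_product_decomposition]): if (L + a_{k+1})u lies in
    the sum of the first k eigenspaces, dividing its i-th component by
    a_{k+1} - a_i gives a correction whose difference from u is killed by
    L + a_{k+1}.

    The analytic content is that Delta is an endomorphism of the space of
    smooth functions ([laplacian_smooth]).  In one chart the function
      - rho^-1 sum_i d_i (rho sum_j g^{ij} d_j u),  rho = |det g|^{1/2},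
    is visibly smooth, but the Laplacian at each point is computed in a chart
    that depends on the point, so smoothness requires that the formula does
    not depend on the chart ([local_laplacian_change]).

    Let phi be a change of coordinates with Jacobian matrix J, and K = J^-1.
    Write F and F' for the vector densities rho sum_j g^{ij} d_j u in the two
    charts.  From g = J (g' o phi) J^T and the chain rule,
      F^i = |det J| sum_k K_{ki} (F'^k o phi) ([gradient_density_change]).
    Differentiating, the terms with derivatives of F' give
    |det J| (sum_k d_k F'^k) o phi, because KJ = 1; the others vanish by the
    Piola identity sum_i d_i (|det J| K_{ki}) = 0 ([piola]).  That identity
    follows from d_i |det J| = |det J| tr (d_i J K), d_i K = - K (d_i J) K and
    the symmetry of second derivatives.  The factor |det J| cancels against
    rho = |det J| (rho' o phi).

    Smoothness is defined through iterated partial derivatives, so the chain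
    rule needs that a function with continuous partial derivatives is
    differentiable ([Ck_on1_differentiable]), and the Piola identity needs the
    theorem of Schwarz ([partialC]); both come from the mean value theorem
    along coordinate directions ([partial_MVT]). *)

Local Open Scope classical_set_scope.
Local Open Scope ring_scope.

Set Implicit Arguments.
Unset Strict Implicit.
Unset Printing Implicit Defensive.

(** * Kernels of products of shifted operators *)

Lemma linear_subspaceZ (R : realType) (V : lmodType R) (S : set V) (a : R) u :
  linear_subspace S -> S u -> S (a *: u).
Proof. by move=> [S0 SL] Su; rewrite -[_ *: _]addr0; exact: SL. Qed.

Lemma linear_subspaceD (R : realType) (V : lmodType R) (S : set V) u v :
  linear_subspace S -> S u -> S v -> S (u + v).
Proof. by move=> [S0 SL] Su Sv; rewrite -[u]scale1r; exact: SL. Qed.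

Lemma linear_subspace_sum (R : realType) (V : lmodType R) (S : set V)
    (I : finType) (v : I -> V) :
  linear_subspace S -> (forall i, S (v i)) -> S (\sum_i v i).
Proof.
move=> SS Sv; elim/big_ind : _ => //; first by case: SS.
by move=> x y; exact: linear_subspaceD.
Qed.

Section shifted_product.
Variables (R : realType) (V : lmodType R) (S : set V) (L : V -> V).
Hypothesis S_sub : linear_subspace S.
Hypothesis L_stable : forall u, S u -> S (L u).
Hypothesis L_linear : forall (a : R) u v, S u -> S v ->
  L (a *: u + v) = a *: L u + L v.

Definition shifted (c : R) (u : V) : V := L u + c *: u.

(** The factor with shift [c 1] is outermost, as in [gjms]. *)
Definition shifted_product (c : nat -> R) (k : nat) : V -> V :=
  \big[(fun A B => A \o B)/id]_(1 <= i < k.+1) shifted (c i).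

(** The eigenvalue is [- c] so that this is the kernel of [shifted c] on [S]. *)
Definition eigenspace_on (c : R) : set V :=
  [set u | S u /\ L u = - c *: u].

Definition kernel_on (A : V -> V) : set V := [set u | S u /\ A u = 0].

Lemma shifted_stable c u : S u -> S (shifted c u).
Proof.
move=> Su; rewrite /shifted addrC; apply: S_sub.2 => //; exact: L_stable.
Qed.

Lemma shifted_linear c (a : R) u v : S u -> S v ->
  shifted c (a *: u + v) = a *: shifted c u + shifted c v.
Proof.
move=> Su Sv; rewrite /shifted L_linear// !scalerDr !scalerA addrACA.
by rewrite [c * a]mulrC.
Qed.

Lemma shifted0 c : shifted c 0 = 0.
Proof.
have S0 := S_sub.1.
have := shifted_linear c 1 S0 S0.
rewrite !scale1r addr0 => /eqP; rewrite -{1}[shifted c 0]add0r => /eqP.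
by move/addIr.
Qed.

Lemma shifted_sum c (I : finType) (v : I -> V) : (forall i, S (v i)) ->
  shifted c (\sum_i v i) = \sum_i shifted c (v i).
Proof.
move=> Sv.
pose K x y := S x /\ shifted c x = y.
suff [] : K (\sum_i v i) (\sum_i shifted c (v i)) by [].
apply: (big_ind2 K) => //; first by split; [exact: S_sub.1|exact: shifted0].
move=> x1 x2 y1 y2 [Sx <-] [Sy <-]; split; first exact: linear_subspaceD.
by rewrite -{1}[x1]scale1r shifted_linear// scale1r.
Qed.

Lemma shifted_eigen c d u : eigenspace_on d u -> shifted c u = (c - d) *: u.
Proof. by move=> [_ Lu]; rewrite /shifted Lu -scalerDl addrC. Qed.

Lemma shifted_eq0 c u : S u -> shifted c u = 0 <-> eigenspace_on c u.
Proof.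
move=> Su; rewrite /shifted; split.
  by move/eqP; rewrite addr_eq0 => /eqP ?; split=> //; rewrite scaleNr.
by move=> [_ ->]; rewrite scaleNr addNr.
Qed.

Lemma eigenspace_on_subspace c : linear_subspace (eigenspace_on c).
Proof.
split; first by apply/shifted_eq0; [exact: S_sub.1|exact: shifted0].
move=> a u v [Su Lu] [Sv Lv]; split; first exact: S_sub.2.
by rewrite L_linear// Lu Lv scalerDr !scalerA mulrC.
Qed.

Lemma shifted_product0 c : shifted_product c 0 = id.
Proof. by rewrite /shifted_product big_geq. Qed.

Lemma shifted_productS c k :
  shifted_product c k.+1 = shifted_product c k \o shifted (c k.+1).
Proof.
rewrite {1}/shifted_product.
have -> : index_iota 1 k.+2 = rcons (index_iota 1 k.+1) k.+1.
  by rewrite /index_iota !subn1 /= -cats1 -(iotaD 1 k 1) addn1.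
rewrite /shifted_product; elim: (index_iota 1 k.+1) => [|i r IH] /=.
  by rewrite big_cons !big_nil.
by rewrite !big_cons IH.
Qed.

Lemma shifted_product_stable_linear c k :
  (forall u, S u -> S (shifted_product c k u)) /\
  (forall (a : R) u v, S u -> S v ->
     shifted_product c k (a *: u + v) =
       a *: shifted_product c k u + shifted_product c k v).
Proof.
elim: k => [|k [IHs IHl]]; first by rewrite shifted_product0.
rewrite shifted_productS; split=> [u Su|a u v Su Sv] /=.
  exact/IHs/shifted_stable.
by rewrite shifted_linear// IHl//; exact: shifted_stable.
Qed.

Lemma shifted_eigen_sum (c : nat -> R) k (v : 'I_k.+1 -> V) :
  (forall i : 'I_k.+1, eigenspace_on (c i.+1) (v i)) ->
  shifted (c k.+1) (\sum_i v i) =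
    \sum_(i < k) (c k.+1 - c i.+1) *: v (widen_ord (leqnSn k) i).
Proof.
move=> Ev; rewrite shifted_sum; last by move=> i; case: (Ev i).
rewrite big_ord_recr /= (shifted_eigen _ (Ev ord_max)) subrr scale0r addr0.
by apply: eq_bigr => i _; rewrite (shifted_eigen _ (Ev _)).
Qed.

(** Induction on [k], peeling off the factor that acts first.  The new shift acts
    on the earlier eigenspaces as the nonzero scalars [c k.+1 - c i.+1] and kills
    the last one: inverting these scalars produces the components of a kernel
    element, and applying the shift to a vanishing sum reduces its length by one. *)
Lemma shifted_product_decomposition (c : nat -> R) k :
  (forall i j, (0 < i)%N -> (0 < j)%N -> c i = c j -> i = j) ->
  internal_direct_sum (kernel_on (shifted_product c k))
    (fun i : 'I_k => eigenspace_on (c i.+1)).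
Proof.
move=> c_inj.
have c_neq k' (i : 'I_k') : c k'.+1 - c i.+1 != 0.
  rewrite subr_eq0; apply/eqP => /c_inj -/(_ isT isT) [] kE.
  by move: (ltn_ord i); rewrite -kE ltnn.
split.
- have [Ps Pl] := shifted_product_stable_linear c k.
  have P0 : shifted_product c k 0 = 0.
    elim: (k) => [|k' IH]; first by rewrite shifted_product0.
    by rewrite shifted_productS /= shifted0.
  split; first by split; [exact: S_sub.1|].
  move=> a u v [Su Pu] [Sv Pv]; split; first exact: S_sub.2.
  by rewrite Pl// Pu Pv scaler0 addr0.
- by move=> i; exact: eigenspace_on_subspace.
- elim: k => [|k IH] w.
    rewrite /kernel_on shifted_product0 /=; split => [[Sw ->]|[v _ ->]].
      by exists (fun=> 0) => [[]|]//; rewrite big_ord0.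
    by rewrite big_ord0; split=> //; exact: S_sub.1.
  rewrite /kernel_on shifted_productS /=; split=> [[Sw Pw]|[v Ev ->]].
    have [|v Ev vE] := (IH (shifted (c k.+1) w)).1.
      by split=> //; exact: shifted_stable.
    (* [z] is a preimage of [shifted (c k.+1) w] in the sum of the first [k]
       eigenspaces; the last component of [w] is what remains. *)
    pose z (i : 'I_k) := (c k.+1 - c i.+1)^-1 *: v i.
    have Ez (i : 'I_k) : eigenspace_on (c i.+1) (z i).
      by apply: linear_subspaceZ; [exact: eigenspace_on_subspace|exact: Ev].
    have Sz : S (\sum_i z i).
      by apply: linear_subspace_sum => // i; case: (Ez i).
    have Szn : S (w - \sum_i z i).
      by rewrite addrC -scaleN1r; exact: S_sub.2.
    exists (fun i : 'I_k.+1 => if unlift ord_max i is Some j then z j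
                               else w - \sum_i z i).
      move=> l; case: unliftP => [j ->|->].
        by have := Ez j; rewrite -lift_max.
      apply/shifted_eq0 => //.
      rewrite addrC -scaleN1r shifted_linear// shifted_sum; last first.
        by move=> j; case: (Ez j).
      rewrite vE scaleN1r; apply/eqP; rewrite addrC subr_eq0; apply/eqP.
      apply: eq_bigr => i _; rewrite (shifted_eigen _ (Ez i)) scalerA.
      by rewrite divff// scale1r.
    rewrite big_ord_recr /= unlift_none.
    rewrite (eq_bigr z) ?subrKC//.
    move=> i _; have -> : widen_ord (leqnSn k) i = lift ord_max i.
      exact/val_inj/esym/lift_max.
    by rewrite liftK.
  have Sv i : S (v i) by case: (Ev i).
  split; first exact: linear_subspace_sum.
  apply: ((IH _).2 _).2.
  exists (fun i : 'I_k => (c k.+1 - c i.+1) *: v (widen_ord (leqnSn k) i)).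
    move=> i; apply: linear_subspaceZ; first exact: eigenspace_on_subspace.
    exact: (Ev (widen_ord _ _)).
  exact: shifted_eigen_sum.
- elim: k => [|k IH] v Ev v0 i; first by case: i.
  have vi (j : 'I_k) : v (widen_ord (leqnSn k) j) = 0.
    pose v' (i : 'I_k) := (c k.+1 - c i.+1) *: v (widen_ord (leqnSn k) i).
    have /eqP : v' j = 0.
      apply: IH => [l|].
        apply: linear_subspaceZ; first exact: eigenspace_on_subspace.
        exact: (Ev (widen_ord _ _)).
      by rewrite -shifted_eigen_sum// v0 shifted0.
    by rewrite scaler_eq0 (negbTE (c_neq _ _)) => /eqP.
  have [j ->|->] := unliftP ord_max i.
    have -> : lift ord_max j = widen_ord (leqnSn k) j.
      exact/val_inj/lift_max.
    exact: vi.
  by move: v0; rewrite big_ord_recr /= big1 ?add0r.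
Qed.

End shifted_product.

(** * Calculus of C^k functions in coordinates *)

Section partial_calculus.
Variables (R : realType) (n : nat).
Implicit Types (f g : 'rV[R]_n -> R) (y : 'rV[R]_n) (i : 'I_n) (U : set 'rV[R]_n).

Lemma eq_on_near U y f g : open U -> U y -> (forall z, U z -> f z = g z) ->
  \near y, f y = g y.
Proof.
move=> oU Uy fg; have : nbhs y U by exact: open_nbhs_nbhs.
by apply: filterS => z /fg.
Qed.

Lemma partial_eq_on i U y f g : open U -> U y ->
  (forall z, U z -> f z = g z) -> partial i f y = partial i g y.
Proof. by move=> oU Uy fg; apply: near_eq_derive; exact: eq_on_near fg. Qed.

Lemma derivable_eq_on i U y f g : open U -> U y ->
  (forall z, U z -> f z = g z) -> derivable f y 'e_i -> derivable g y 'e_i.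
Proof. by move=> oU Uy fg; apply: near_eq_derivable; exact: eq_on_near fg. Qed.

Lemma continuous_eq_on U y f g : open U -> U y ->
  (forall z, U z -> f z = g z) -> {for y, continuous f} -> {for y, continuous g}.
Proof.
move=> oU Uy fg cf; rewrite /prop_for /continuous_at -(fg y Uy).
apply: cvg_trans cf; apply: near_eq_cvg; first exact: nbhs_filter.
exact: (eq_on_near oU Uy fg).
Qed.

Lemma partialD i y f g : derivable f y 'e_i -> derivable g y 'e_i ->
  partial i (fun z => f z + g z) y = partial i f y + partial i g y.
Proof. exact: deriveD. Qed.

Lemma partialM i y f g : derivable f y 'e_i -> derivable g y 'e_i ->
  partial i (fun z => f z * g z) y = f y * partial i g y + g y * partial i f y.
Proof. exact: deriveM. Qed.

Lemma partial_cst i y (c : R) : partial i (fun=> c) y = 0.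
Proof. exact: derive_cst. Qed.

(** Both difference quotients are the same function of the increment, so
    directional derivatives are derivatives of the restriction to a line. *)
Lemma growth_rate_line f y (v : 'rV[R]_n) (t : R) :
  (fun h : R => h^-1 *: (((fun s => f (y + s *: v)) \o shift t) (h *: 1)
                        - f (y + t *: v))) =
  (fun h : R => h^-1 *: ((f \o shift (y + t *: v)) (h *: v) - f (y + t *: v))).
Proof.
apply/funext => h /=; congr (_ *: (f _ - _)).
by rewrite [h *: 1]mulr1 scalerDl addrCA.
Qed.

Lemma is_derive_line f y (v : 'rV[R]_n) (t d : R) :
  is_derive (y + t *: v) v f d <-> is_derive t 1 (fun s => f (y + s *: v)) d.
Proof.
split=> -[df <-]; split; move: df;
  by rewrite /derivable /derive growth_rate_line.
Qed.

Lemma partial_sum m i y (f : 'I_m -> 'rV[R]_n -> R) :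
  (forall j, derivable (f j) y 'e_i) ->
  partial i (fun z => \sum_(j < m) f j z) y = \sum_(j < m) partial i (f j) y.
Proof.
move=> df; rewrite /partial; have <- := fct_sumE (index_enum _) xpredT f.
exact: derive_sum.
Qed.

Lemma partialV i y f : f y != 0 -> derivable f y 'e_i ->
  partial i (fun z => (f z)^-1) y = - ((f y)^-1 * (f y)^-1) * partial i f y.
Proof. by move=> f0 df; rewrite /partial deriveV// -invfM -expr2. Qed.

(** Restricted to the line through [y] in direction [i], this is the chain rule in
    one variable. *)
Lemma is_derive_sqrt_comp i y f : 0 < f y -> {for y, continuous f} ->
  derivable f y 'e_i ->
  is_derive y 'e_i (fun z => Num.sqrt (f z))
    ((2 * Num.sqrt (f y))^-1 * partial i f y).
Proof.
move=> f0 cf df.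
have {}df : is_derive (0 : R) (1 : R) (fun s : R => f (y + s *: 'e_i)) (partial i f y).
  by apply/is_derive_line; rewrite scale0r addr0; exact: derivableP.
have y0 : y = y + 0 *: 'e_i by rewrite scale0r addr0.
rewrite {1}y0; apply/is_derive_line.
apply: (@is_derive1_comp _ Num.sqrt (fun s : R => f (y + s *: 'e_i))) => //.
by rewrite -y0; exact: is_derive1_sqrt.
Qed.

End partial_calculus.

Section Ck_calculus.
Variables (R : realType) (n : nat) (U : set 'rV[R]_n).
Hypothesis U_open : open U.
Implicit Types (f g : 'rV[R]_n -> R).

Lemma Ck_on_continuous k f : Ck_on k U f -> forall y, U y -> {for y, continuous f}.
Proof. by case: k => [|k] []. Qed.

Lemma Ck_onW k f : Ck_on k.+1 U f -> Ck_on k U f.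
Proof.
elim: k f => [|k IH] f [cf df]; first by split.
by split=> // i; have [dfi Cfi] := df i; split=> //; exact: IH.
Qed.

Lemma Ck_on_eq k f g : (forall y, U y -> f y = g y) -> Ck_on k U f -> Ck_on k U g.
Proof.
elim: k f g => [|k IH] f g fg [cf df]; split.
- by move=> y Uy; apply: continuous_eq_on fg (cf y Uy).
- by [].
- by move=> y Uy; apply: continuous_eq_on fg (cf y Uy).
- move=> i; have [dfi Cfi] := df i; split=> [y Uy|].
    by apply: derivable_eq_on fg _ => //; exact: dfi.
  by apply: IH Cfi => y Uy; exact: partial_eq_on fg.
Qed.

Lemma Ck_on_cst k (c : R) : Ck_on k U (fun=> c).
Proof.
elim: k c => [|k IH] c; split=> //; try by move=> y _; exact: cst_continuous.
move=> i; split=> [y _|]; first exact: derivable_cst.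
by apply: Ck_on_eq (IH 0) => y _; rewrite partial_cst.
Qed.

Lemma Ck_onD k f g : Ck_on k U f -> Ck_on k U g -> Ck_on k U (fun y => f y + g y).
Proof.
elim: k f g => [|k IH] f g [cf df] [cg dg]; split=> //;
  try by move=> y Uy; apply: continuousD; [exact: cf|exact: cg].
move=> i; have [dfi Cf] := df i; have [dgi Cg] := dg i; split=> [y Uy|].
  by apply: derivableD; [exact: dfi|exact: dgi].
apply: Ck_on_eq (IH _ _ Cf Cg) => y Uy.
by rewrite partialD//; [exact: dfi|exact: dgi].
Qed.

Lemma Ck_onM k f g : Ck_on k U f -> Ck_on k U g -> Ck_on k U (fun y => f y * g y).
Proof.
elim: k f g => [|k IH] f g Cf Cg.
  by split=> // y Uy; apply: continuousM;
    [exact: (Ck_on_continuous Cf)|exact: (Ck_on_continuous Cg)].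
split.
  by move=> y Uy; apply: continuousM;
    [exact: (Ck_on_continuous Cf)|exact: (Ck_on_continuous Cg)].
have := Ck_onW Cf; have := Ck_onW Cg; case: Cf Cg => [_ df] [_ dg] Cg Cf.
move=> i; have [dfi Cdf] := df i; have [dgi Cdg] := dg i; split=> [y Uy|].
  by apply: derivableM; [exact: dfi|exact: dgi].
apply: Ck_on_eq (Ck_onD (IH _ _ Cf Cdg) (IH _ _ Cg Cdf)) => y Uy.
by rewrite partialM//; [exact: dfi|exact: dgi].
Qed.

Lemma Ck_onV k f : (forall y, U y -> f y != 0) -> Ck_on k U f ->
  Ck_on k U (fun y => (f y)^-1).
Proof.
move=> f0; elim: k => [|k IH] Cf.
  by split=> // y Uy; apply: continuousV; [exact: f0|exact: (Ck_on_continuous Cf)].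
split.
  by move=> y Uy; apply: continuousV; [exact: f0|exact: (Ck_on_continuous Cf)].
have CV := IH (Ck_onW Cf); case: Cf => [_ df] i; have [dfi Cdf] := df i.
split=> [y Uy|]; first by apply: derivableV; [exact: f0|exact: dfi].
apply: Ck_on_eq (Ck_onM (Ck_onM (Ck_on_cst k (-1)) (Ck_onM CV CV)) Cdf) => y Uy.
by rewrite partialV ?mulN1r//; [exact: f0|exact: dfi].
Qed.

(** The partial derivatives of [sqrt f] involve [sqrt f] itself, to which the
    induction hypothesis applies at one order less. *)
Lemma Ck_on_sqrt k f : (forall y, U y -> 0 < f y) -> Ck_on k U f ->
  Ck_on k U (fun y => Num.sqrt (f y)).
Proof.
move=> f0; elim: k => [|k IH] Cf.
  split=> // y Uy; apply: continuous_comp; first exact: (Ck_on_continuous Cf).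
  exact: sqrt_continuous.
have Cs := IH (Ck_onW Cf); have := Ck_on_continuous Cf.
case: Cf => [_ df] cf; split.
  move=> y Uy; apply: continuous_comp; first exact: cf.
  exact: sqrt_continuous.
move=> i; have [dfi Cdf] := df i.
have ds y : U y -> _ := fun Uy => is_derive_sqrt_comp (f0 _ Uy) (cf _ Uy) (dfi _ Uy).
split=> [y /ds[]//|].
have s0 y : U y -> 2 * Num.sqrt (f y) != 0.
  by move=> Uy; rewrite mulf_neq0 ?pnatr_eq0// gt_eqF// sqrtr_gt0 f0.
apply: Ck_on_eq (Ck_onM (Ck_onV s0 (Ck_onM (Ck_on_cst k 2) Cs)) Cdf) => y Uy.
by rewrite /partial; have [_ ->] := ds _ Uy.
Qed.

Lemma Ck_on_sum k (I : Type) (r : seq I) (P : pred I) (f : I -> 'rV[R]_n -> R) :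
  (forall j, Ck_on k U (f j)) -> Ck_on k U (fun y => \sum_(j <- r | P j) f j y).
Proof.
move=> Cf; elim: r => [|j r IH].
  by apply: Ck_on_eq (Ck_on_cst k 0) => y _; rewrite big_nil.
have [Pj|/negbTE Pj] := boolP (P j).
  by apply: Ck_on_eq (Ck_onD (Cf j) IH) => y _; rewrite big_cons Pj.
by apply: Ck_on_eq IH => y _; rewrite big_cons Pj.
Qed.

Lemma Ck_on_prod k (I : Type) (r : seq I) (P : pred I) (f : I -> 'rV[R]_n -> R) :
  (forall j, Ck_on k U (f j)) -> Ck_on k U (fun y => \prod_(j <- r | P j) f j y).
Proof.
move=> Cf; elim: r => [|j r IH].
  by apply: Ck_on_eq (Ck_on_cst k 1) => y _; rewrite big_nil.
have [Pj|/negbTE Pj] := boolP (P j).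
  by apply: Ck_on_eq (Ck_onM (Cf j) IH) => y _; rewrite big_cons Pj.
by apply: Ck_on_eq IH => y _; rewrite big_cons Pj.
Qed.

End Ck_calculus.

Section smooth_calculus.
Variables (R : realType) (n : nat) (U : set 'rV[R]_n).
Hypothesis U_open : open U.
Implicit Types (f g : 'rV[R]_n -> R).

Lemma smooth_on_derivable f i y : smooth_on U f -> U y -> derivable f y 'e_i.
Proof. by move=> /(_ 1)[_ /(_ i)[df _]] /df. Qed.

Lemma smooth_on_partial f i : smooth_on U f -> smooth_on U (partial i f).
Proof. by move=> Sf k; have [_ /(_ i)[]] := Sf k.+1. Qed.

Lemma smooth_on_det m (A : 'rV[R]_n -> 'M[R]_m) :
  (forall i j, smooth_on U (fun y => A y i j)) -> smooth_on U (fun y => \det (A y)).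
Proof.
move=> SA k; rewrite /determinant; apply: Ck_on_sum => // s.
apply: Ck_onM => //; first exact: Ck_on_cst.
by apply: Ck_on_prod => // i; exact: SA.
Qed.

Lemma smooth_on_adj m (A : 'rV[R]_n -> 'M[R]_m) :
  (forall i j, smooth_on U (fun y => A y i j)) ->
  forall i j, smooth_on U (fun y => (\adj (A y)) i j).
Proof.
move=> SA i j k.
apply: (Ck_on_eq U_open) (_ : Ck_on k U (fun y => cofactor (A y) j i)).
  by move=> y _; rewrite mxE.
rewrite /cofactor; apply: Ck_onM => //; first exact: Ck_on_cst.
apply: smooth_on_det => i' j' k'.
apply: (Ck_on_eq U_open) (SA (lift j i') (lift i j') k').
by move=> y _; rewrite !mxE.
Qed.

(** Cramer's rule expresses the entries of the inverse by determinants. *)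
Lemma smooth_on_invmx m (A : 'rV[R]_n -> 'M[R]_m) :
  (forall y, U y -> A y \in unitmx) ->
  (forall i j, smooth_on U (fun y => A y i j)) ->
  forall i j, smooth_on U (fun y => invmx (A y) i j).
Proof.
move=> Au SA i j k.
apply: (Ck_on_eq U_open)
  (_ : Ck_on k U (fun y => (\det (A y))^-1 * (\adj (A y)) i j)).
  by move=> y Uy; rewrite /invmx Au// [RHS]mxE.
apply: Ck_onM => //; last exact: smooth_on_adj.
apply: Ck_onV => //; last exact: smooth_on_det.
by move=> y /Au; rewrite unitmxE unitfE.
Qed.

(** The absolute value of a nonvanishing function is [sqrt (f * f)], which avoids a
    discussion of its sign. *)
Lemma smooth_on_abs f : (forall y, U y -> f y != 0) -> smooth_on U f ->
  smooth_on U (fun y => `|f y|).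
Proof.
move=> f0 Sf k.
apply: (Ck_on_eq U_open) (_ : Ck_on k U (fun y => Num.sqrt (f y * f y))).
  by move=> y _; rewrite -expr2 sqrtr_sqr.
apply: Ck_on_sqrt => //; last by apply: Ck_onM => //; exact: Sf.
by move=> y Uy; rewrite -expr2 exprn_even_gt0 //= f0.
Qed.

End smooth_calculus.

(** * Mean value estimates along coordinate directions *)

Section mean_value.
Variables (R : realType) (n : nat).
Implicit Types (f g : 'rV[R]_n -> R) (y h : 'rV[R]_n) (i : 'I_n) (U : set 'rV[R]_n).

(** The intermediate point is controlled through absolute values only, which spares
    the users from distinguishing the sign of [a]. *)
Lemma partial_MVT f i y (a : R) :
  (forall t, `|t| <= `|a| -> derivable f (y + t *: 'e_i) 'e_i) ->
  exists2 t, `|t| <= `|a| &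
    f (y + a *: 'e_i) - f y = a * partial i f (y + t *: 'e_i).
Proof.
move=> df; pose F (s : R) := f (y + s *: 'e_i).
have dF t : `|t| <= `|a| -> is_derive t (1 : R) F (partial i f (y + t *: 'e_i)).
  by move=> ta; apply/is_derive_line/derivableP/df.
have F0 : F 0 = f y by rewrite /F scale0r addr0.
rewrite -F0 -[f (_ + a *: _)]/(F a).
have [a0|a0] := leP 0 a.
  have bnd t : t \in `[0, a]%R -> `|t| <= `|a|.
    by rewrite in_itv /= => /andP[t0 ta]; rewrite !ger0_norm.
  have [|||t tI ->] := @MVT_segment _ F (fun s => partial i f (y + s *: 'e_i)) 0 a.
  - by [].
  - move=> t tI; apply/dF/bnd; apply: subset_itv_oo_cc tI.
  - by apply: derivable_within_continuous => t /bnd/dF[].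
  by exists t; [exact: bnd|rewrite subr0 mulrC].
have bnd t : t \in `[a, 0]%R -> `|t| <= `|a|.
  by rewrite in_itv /= => /andP[ta t0]; rewrite !ler0_norm ?lerN2// ltW.
have [|||t tI Ft] := @MVT_segment _ F (fun s => partial i f (y + s *: 'e_i)) a 0.
- exact: ltW.
- move=> t tI; apply/dF/bnd; apply: subset_itv_oo_cc tI.
- by apply: derivable_within_continuous => t /bnd/dF[].
by exists t; [exact: bnd|rewrite -[LHS]opprB Ft sub0r mulrN opprK mulrC].
Qed.

Lemma row_norm_le (v : 'rV[R]_n) (e : R) : 0 <= e ->
  (forall i, `|v ord0 i| <= e) -> `|v| <= e.
Proof.
move=> e0 ve; rewrite /Num.Def.normr /= mx_normrE.
by apply: bigmax_le => // -[i j] _ /=; rewrite (ord1 i).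
Qed.

Lemma coord_le_norm (v : 'rV[R]_n) i : `|v ord0 i| <= `|v|.
Proof.
rewrite [leRHS]/Num.Def.normr /= mx_normrE.
exact: (le_bigmax _ (fun ij : 'I_1 * 'I_n => `|v ij.1 ij.2|) (ord0, i)).
Qed.

Lemma norm_scale_delta (t : R) i : `|t *: ('e_i : 'rV[R]_n)| <= `|t|.
Proof.
apply: row_norm_le => // j; rewrite !mxE.
by rewrite normrM; case: (_ == _); case: (_ == _); rewrite ?normr1 ?normr0 ?mulr1 ?mulr0.
Qed.

(** The first [m] coordinates of [h]: the vertices of the path from [0] to [h] that
    moves along one coordinate at a time. *)
Definition row_prefix (h : 'rV[R]_n) (m : nat) : 'rV[R]_n :=
  \row_j (if (j < m)%N then h ord0 j else 0).

Lemma row_prefix0 h : row_prefix h 0 = 0.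
Proof. by apply/rowP => j; rewrite !mxE ltn0. Qed.

Lemma row_prefix_full h : row_prefix h n = h.
Proof. by apply/rowP => j; rewrite !mxE ltn_ord. Qed.

Lemma row_prefixS h (i : 'I_n) :
  row_prefix h i.+1 = row_prefix h i + h ord0 i *: 'e_i.
Proof.
apply/rowP => j; rewrite !mxE eqxx /= ltnS leq_eqVlt -(inj_eq val_inj).
have [ij|_] /= := eqVneq (val j) (val i).
  by rewrite ij ltnn add0r mulr1; congr (h _ _); exact: val_inj.
by rewrite mulr0 addr0.
Qed.

Lemma row_prefix_line_norm h (i : 'I_n) (t : R) : `|t| <= `|h ord0 i| ->
  `|row_prefix h i + t *: 'e_i| <= `|h|.
Proof.
move=> th; apply: row_norm_le => // j; rewrite !mxE eqxx /=.
have [->|ji] := eqVneq j i.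
  by rewrite ltnn add0r mulr1 (le_trans th)// coord_le_norm.
rewrite mulr0 addr0; case: ifP => _; first exact: coord_le_norm.
by rewrite normr0.
Qed.

(** The increment is telescoped along the path of the vectors [row_prefix h m]; the
    mean value theorem bounds each of the [n] steps by [e * `|h|]. *)
Lemma increment_le_partials f y (r e : R) :
  (forall z, `|z| < r -> forall i, derivable f (y + z) 'e_i /\
     `|partial i f (y + z)| <= e) -> 0 <= e ->
  forall h, `|h| < r -> `|f (y + h) - f y| <= n%:R * e * `|h|.
Proof.
move=> df e0 h hr.
have step (m : nat) : (m <= n)%N ->
    `|f (y + row_prefix h m) - f y| <= m%:R * e * `|h|.
  elim: m => [|m IH] mn; first by rewrite row_prefix0 addr0 subrr normr0 !mul0r.
  pose i := Ordinal mn.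
  have [t ti ft] : exists2 t, `|t| <= `|h ord0 i| &
      f (y + row_prefix h m + h ord0 i *: 'e_i) - f (y + row_prefix h m) =
      h ord0 i * partial i f (y + row_prefix h m + t *: 'e_i).
    apply: partial_MVT => t th; rewrite -addrA; apply: (df _ _ i).1.
    by apply: le_lt_trans hr; exact: (@row_prefix_line_norm h i).
  rewrite (row_prefixS h i) addrA -(subrKA (f (y + row_prefix h m))) ft.
  apply: (le_trans (ler_normD _ _)); rewrite addrC -[m.+1]addn1 natrD !mulrDl mul1r.
  apply: lerD; first exact: IH (ltnW mn).
  rewrite normrM mulrC -addrA ler_pM//; last exact: coord_le_norm.
  apply: (df _ _ i).2; apply: le_lt_trans hr; exact: (@row_prefix_line_norm h i).
by rewrite -{1}(row_prefix_full h); exact: step.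
Qed.

End mean_value.

(** * Continuously differentiable functions and second derivatives *)

Lemma near_norm_ball (R : realType) (V : normedModType R) (y : V) (P : V -> Prop) :
  (\forall z \near y, P z) <->
  exists2 r : R, 0 < r & forall z, `|z| < r -> P (y + z).
Proof.
have ballE r z : ball y r z = (`|z - y| < r) :> Prop.
  by rewrite -ball_normE /= distrC.
split=> [/nbhs_ballP[r r0 rP]|[r r0 rP]].
  by exists r => // z zr; apply: rP; rewrite ballE addrAC subrr add0r.
by apply/nbhs_ballP; exists r => // z; rewrite ballE => /rP; rewrite addrC subrK.
Qed.

(** The estimate says that the zero map is the differential at [y]. *)
Lemma differentiable_flat (R : realType) (V W : normedModType R) (f : V -> W) (y : V) :
  (forall e : R, 0 < e ->
     exists2 r : R, 0 < r & forall h, `|h| < r -> `|f (y + h) - f y| <= e * `|h|) ->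
  differentiable f y.
Proof.
move=> flat.
pose d : {linear V -> W} := \0.
have d_cont : continuous d by exact: cst_continuous.
have fo : f \o shift y = cst (f y) + d +o_ 0 id.
  apply/eqaddoP => _/posnumP[e].
  have [|r r0 rP] := flat e%:num; first by [].
  apply/near_norm_ball; exists r => // h hr; rewrite add0r /=.
  have := rP h hr.
  by rewrite !fctE /d /= addr0 [y + h]addrC.
by apply/diff_locallyP; rewrite (diff_unique d_cont fo).
Qed.

Section continuous_partials.
Variables (R : realType) (n : nat).
Implicit Types (f g : 'rV[R]_n -> R) (y h : 'rV[R]_n) (i : 'I_n) (U : set 'rV[R]_n).

(** When the partial derivatives vanish at [y] they are small nearby, so the
    increments of [f] are of smaller order than the displacement. *)
Lemma Ck_on1_flat_differentiable U f y : open U -> U y -> Ck_on 1 U f ->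
  (forall i, partial i f y = 0) -> differentiable f y.
Proof.
move=> oU Uy Cf f0; apply: differentiable_flat => e e0.
(* Dividing by [n.+1] instead of [n] covers dimension zero. *)
have e'0 : 0 < e / n.+1%:R by rewrite divr_gt0.
have small : \forall z \near y, forall i, derivable f z 'e_i /\
    `|partial i f z| <= e / n.+1%:R.
  apply: (@filter_forall _ _ (fun i z => derivable f z 'e_i /\
    `|partial i f z| <= e / n.+1%:R) (nbhs y)) => i.
  case: Cf => _ /(_ i)[df [/(_ y Uy) cf _]].
  have nU : \forall z \near y, U z by apply: open_nbhs_nbhs; split.
  have nf := (cvgrPdist_le _ _).1 cf _ e'0; near=> z.
  split; first by apply: df; near: z.
  by rewrite -normrN -sub0r -{1}(f0 i); near: z; exact: nf.
have [r r0 rP] := (near_norm_ball _ _).1 small.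
exists r => // h hr.
have inc := increment_le_partials rP (ltW e'0) hr; apply: (le_trans inc).
apply: ler_wpM2r => //; rewrite mulrCA ger_pMr//.
by rewrite ler_pdivrMr// mul1r ler_nat.
Unshelve. all: by end_near. Qed.

Lemma partial_coord i j y : partial i (fun z => z ord0 j) y = (i == j)%:R.
Proof.
have := derive_mx (@derivable_id _ _ y ('e_i : 'rV[R]_n)).
by rewrite derive_id => /rowP/(_ j); rewrite !mxE eqxx eq_sym.
Qed.

Lemma derivable_coord i j y : derivable (fun z : 'rV[R]_n => z ord0 j) y 'e_i.
Proof. exact/diff_derivable/differentiable_coord. Qed.

Lemma Ck_on_coord k U j : open U -> Ck_on k U (fun z => z ord0 j).
Proof.
move=> oU; case: k => [|k]; first by split=> // y _; exact: coord_continuous.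
split=> [y _|i]; first exact: coord_continuous.
split=> [y _|]; first exact: derivable_coord.
by apply: (Ck_on_eq oU) (Ck_on_cst oU k (i == j)%:R) => y _; rewrite partial_coord.
Qed.

(** Subtracting the linear function with the same partial derivatives at [y] reduces
    the claim to vanishing partial derivatives. *)
Lemma Ck_on1_differentiable U f y : open U -> U y -> Ck_on 1 U f -> differentiable f y.
Proof.
move=> oU Uy Cf.
pose l (z : 'rV[R]_n) := \sum_(j < n) partial j f y * z ord0 j.
have dl z : differentiable l z.
  rewrite /l; have <- := fct_sumE (index_enum _) xpredT
    (fun j (z : 'rV[R]_n) => partial j f y * z ord0 j).
  apply: differentiable_sum => j.
  apply: (@differentiableZ _ _ _ (fun z : 'rV[R]_n => z ord0 j)).
  exact: differentiable_coord.
have pl i : partial i l y = partial i f y.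
  rewrite partial_sum; last first.
    by move=> j; apply: derivableM; [exact: derivable_cst|exact: derivable_coord].
  rewrite (bigD1 i)//= big1 => [|j ji].
    rewrite partialM; [|exact: derivable_cst|exact: derivable_coord].
    by rewrite partial_cst partial_coord eqxx !mulr0 mulr1 !addr0.
  rewrite partialM; [|exact: derivable_cst|exact: derivable_coord].
  by rewrite partial_cst partial_coord eq_sym (negbTE ji) !mulr0 addr0.
have Cl : Ck_on 1 U (fun z => -1 * l z).
  apply: (Ck_onM oU (Ck_on_cst oU 1 (-1))); apply: (Ck_on_sum oU) => j.
  exact: (Ck_onM oU (Ck_on_cst oU 1 _) (Ck_on_coord 1 j oU)).
have -> : f = (fun z => f z + -1 * l z) + l.
  by apply/funext => z; rewrite fctE mulN1r subrK.
apply: differentiableD => //; apply: (Ck_on1_flat_differentiable oU Uy).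
  exact: Ck_onD.
move=> i; case: Cf Cl => _ /(_ i)[df _] [_ /(_ i)[dl' _]].
rewrite partialD; [|exact: df|exact: dl'].
rewrite partialM; [|exact: derivable_cst|exact: diff_derivable].
by rewrite partial_cst pl mulr0 addr0 mulN1r subrr.
Qed.

Lemma is_derive_translate f y (v w : 'rV[R]_n) (d : R) :
  is_derive (y + w) v f d -> is_derive y v (fun z => f (z + w)) d.
Proof.
have E : (fun h : R => h^-1 *: (((fun z => f (z + w)) \o shift y) (h *: v) - f (y + w)))
       = (fun h : R => h^-1 *: ((f \o shift (y + w)) (h *: v) - f (y + w))).
  by apply/funext => h /=; rewrite addrA.
by move=> [df <-]; split; move: df; rewrite /derivable /derive E.
Qed.

(** Two applications of the mean value theorem: in direction [i] to the function
    [z |-> f (z + a e_j) - f z], then in direction [j] to [partial i f]. *)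
Lemma second_difference_MVT U f i j y (r a : R) : Ck_on 2 U f ->
  (forall z, `|z| < r -> U (y + z)) -> `|a| + `|a| < r ->
  exists2 z, `|z| <= `|a| + `|a| &
    f (y + a *: 'e_i + a *: 'e_j) - f (y + a *: 'e_i) - (f (y + a *: 'e_j) - f y)
      = a * (a * partial j (partial i f) (y + z)).
Proof.
move=> [_ /(_ i)[di [_ /(_ j)[dj _]]]] rU ar.
have inU (s t : R) : `|s| <= `|a| -> `|t| <= `|a| -> U (y + s *: 'e_i + t *: 'e_j).
  move=> sa ta; rewrite -addrA; apply: rU; apply: le_lt_trans ar.
  by apply: (le_trans (ler_normD _ _)); apply: lerD;
    apply: le_trans (norm_scale_delta _ _) _.
have a0 : `|0 : R| <= `|a| by rewrite normr0.
pose F z := f (z + a *: 'e_j) - f z.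
have dF s : `|s| <= `|a| -> is_derive (y + s *: 'e_i) 'e_i F
   (partial i f (y + s *: 'e_i + a *: 'e_j) - partial i f (y + s *: 'e_i)).
  move=> sa; apply: is_deriveB.
    by apply/is_derive_translate/derivableP/di; exact: inU.
  by apply/derivableP/di; have := inU s 0 sa a0; rewrite scale0r addr0.
have [s sa] : exists2 s, `|s| <= `|a| &
    F (y + a *: 'e_i) - F y = a * partial i F (y + s *: 'e_i).
  by apply: partial_MVT => t /dF[].
have -> : partial i F (y + s *: 'e_i) =
    partial i f (y + s *: 'e_i + a *: 'e_j) - partial i f (y + s *: 'e_i).
  by case: (dF s sa).
move=> Fs.
have [|t ta ft] := @partial_MVT _ _ (partial i f) j (y + s *: 'e_i) a.
  by move=> t ta; apply: dj; exact: inU.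
exists (s *: 'e_i + t *: 'e_j).
  by apply: (le_trans (ler_normD _ _)); apply: lerD;
    apply: le_trans (norm_scale_delta _ _) _.
by rewrite addrA -ft -Fs.
Qed.

(** The second difference of [f] is symmetric in the two directions, and by
    [second_difference_MVT] it equals [a ^ 2] times either mixed derivative at points
    that tend to [y] with [a]. *)
Lemma partialC U f i j y : open U -> U y -> Ck_on 2 U f ->
  partial i (partial j f) y = partial j (partial i f) y.
Proof.
move=> oU Uy Cf.
have oUy : \forall z \near y, U z by apply: open_nbhs_nbhs; split.
have [r r0 rU] := (near_norm_ball _ _).1 oUy.
have cont k l : {for y, continuous (partial k (partial l f))}.
  by case: Cf => _ /(_ l)[_ [_ /(_ k)[_ [/(_ y Uy)]]]].
apply/eqP; rewrite -subr_eq0 -normr_le0; apply/ler_addgt0Pr => e e0; rewrite add0r.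
have e20 : 0 < e / 2 by rewrite divr_gt0.
have small k l : exists2 d : R, 0 < d & forall z, `|z| < d ->
    `|partial k (partial l f) y - partial k (partial l f) (y + z)| <= e / 2.
  exact: (near_norm_ball _ _).1 ((cvgrPdist_le _ _).1 (cont k l) _ e20).
have [d d0 dP] := small i j; have [d' d'0 d'P] := small j i.
(* Steps of size [a] stay where both mixed derivatives are within [e / 2] of their
   values at [y]. *)
have [m [m0 mr md md']] : exists m, [/\ 0 < m, m <= r, m <= d & m <= d'].
  exists (Num.min r (Num.min d d')); split;
    by rewrite ?lt_min ?ge_min ?r0 ?d0 ?d'0 ?lexx ?orbT.
have [a a0 aam] : exists2 a : R, 0 < a & `|a| + `|a| < m.
  by exists (m / 3); [rewrite divr_gt0|rewrite gtr0_norm ?divr_gt0//; lra].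
have [z za fz] := @second_difference_MVT U f i j y r a Cf rU (lt_le_trans aam mr).
have [w wa fw] := @second_difference_MVT U f j i y r a Cf rU (lt_le_trans aam mr).
have E : y + a *: 'e_i + a *: 'e_j = y + a *: 'e_j + a *: 'e_i.
  exact: addrAC.
have := dP w (le_lt_trans wa (lt_le_trans aam md)).
have := d'P z (le_lt_trans za (lt_le_trans aam md')).
move: fz fw; rewrite E.
move: (partial j (partial i f) (y + z)) (partial i (partial j f) (y + w)).
move: (partial j (partial i f) y) (partial i (partial j f) y) => P Q X Y.
move: (f (y + a *: 'e_i)) (f (y + a *: 'e_j)) (f (_ + _)) (f y) => p1 p2 p3 p4.
move=> fz fw PX QY.
have XY : a * (a * X) = a * (a * Y) by rewrite -fz -fw; ring.
have an0 : a != 0 by rewrite gt_eqF.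
move: PX; rewrite (mulfI an0 (mulfI an0 XY)) distrC => PY.
rewrite (splitr e) -(subrKA Y).
exact: le_trans (ler_normD _ _) (lerD QY PY).
Qed.

End continuous_partials.

(** * Chain rule and the derivative of the determinant *)

Section chain_rule.
Variables (R : realType) (n m : nat).
Implicit Types (phi : 'rV[R]_n -> 'rV[R]_m) (y : 'rV[R]_n).

Lemma differentiable_row phi y :
  (forall j, differentiable (fun z => phi z ord0 j) y) -> differentiable phi y.
Proof.
move=> dphi.
have -> : phi = \sum_(j < m) (fun z => phi z ord0 j *: ('e_j : 'rV[R]_m)).
  by apply/funext => z; rewrite fct_sumE [LHS]row_sum_delta.
by apply: differentiable_sum => j; exact: differentiableZl.
Qed.

Lemma derive_row phi y (v : 'rV[R]_n) : differentiable phi y ->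
  'D_v phi y = \row_j 'D_v (fun z => phi z ord0 j) y.
Proof.
move=> dphi; rewrite derive_mx; last exact: diff_derivable.
by apply/rowP => j; rewrite !mxE.
Qed.

Lemma jacobian_partial phi y : differentiable phi y ->
  'J phi y = \matrix_(i, j) partial i (fun z => phi z ord0 j) y.
Proof.
move=> dphi; apply/row_matrixP => i.
by rewrite rowE -deriveEjacobian// derive_row//; apply/rowP => j; rewrite !mxE.
Qed.

Lemma partial_comp i phi (f : 'rV[R]_m -> R) y :
  differentiable phi y -> differentiable f (phi y) ->
  partial i (f \o phi) y =
    \sum_j partial i (fun z => phi z ord0 j) y * partial j f (phi y).
Proof.
move=> dphi df; rewrite /partial deriveE; last exact: differentiable_comp.
rewrite diff_comp//= -[X in 'd f _ X]deriveE// derive_row//.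
rewrite [X in 'd f _ X]row_sum_delta linear_sum; apply: eq_bigr => j _.
by rewrite linearZ mxE -deriveE.
Qed.

End chain_rule.

Section determinant_derivative.
Variables (R : realType) (V : normedModType R).
Implicit Types (y v : V).

Lemma is_derive_sum_fun (I : Type) (r : seq I) y v (F : I -> V -> R) (dF : I -> R) :
  (forall j, is_derive y v (F j) (dF j)) ->
  is_derive y v (fun z => \sum_(j <- r) F j z) (\sum_(j <- r) dF j).
Proof.
move=> dFj; rewrite -fct_sumE; elim/big_ind2 : _ => //; first exact: is_derive_cst.
by move=> *; exact: is_deriveD.
Qed.

Lemma is_derive_prod_fun (I : eqType) (r : seq I) y v (F : I -> V -> R) (dF : I -> R) :
  uniq r -> (forall j, is_derive y v (F j) (dF j)) ->
  is_derive y v (fun z => \prod_(j <- r) F j z)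
    (\sum_(j <- r) dF j * \prod_(k <- r | k != j) F k y).
Proof.
move=> + dFj; elim: r => [_|a r IH /= /andP[ar ur]].
  rewrite big_nil; under eq_fun do rewrite big_nil; exact: is_derive_cst.
under eq_fun do rewrite big_cons.
apply: is_derive_eq; first exact: is_deriveM (dFj a) (IH ur).
rewrite /GRing.scale /= 2!big_cons eqxx /= addrC mulrC; congr (_ * _ + _).
  rewrite big_seq_cond [RHS]big_seq_cond; apply: eq_bigl => k.
  case: (boolP (k \in r)) => //= kr; apply/esym; apply: contraNN ar => /eqP <-.
  by [].
rewrite big_distrr big_seq [RHS]big_seq; apply: eq_bigr => j jr.
rewrite big_cons; case: eqP => [aj|_]; first by move: ar; rewrite aj jr.
by rewrite /= mulrCA.
Qed.

(** Each term of the Leibniz formula is a product with one factor per row.  The terms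
    in which row [i] is differentiated add up to the determinant of the matrix whose
    row [i] is replaced by that of [dA]; expanding it along this row gives
    [(dA *m \adj (A y)) i i]. *)
Lemma is_derive_det m (A : V -> 'M[R]_m) (dA : 'M[R]_m) y v :
  (forall i j, is_derive y v (fun z => A z i j) (dA i j)) ->
  is_derive y v (fun z => \det (A z)) (\tr (dA *m \adj (A y))).
Proof.
move=> dAij; rewrite /determinant.
pose B i := \matrix_(k, l) (if k == i then dA i l else A y k l).
have detB i : \det (B i) = (dA *m \adj (A y)) i i.
  rewrite (expand_det_row _ i) mxE; apply: eq_bigr => j _.
  rewrite !mxE eqxx; congr (_ * (_ * \det _)).
  by apply/matrixP => k l; rewrite !mxE eq_sym (negbTE (neq_lift _ _)).
have dprod (s : 'S_m) := is_derive_prod_fun (index_enum_uniq _)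
  (fun i => dAij i (s i)).
apply: is_derive_eq.
  exact: (is_derive_sum_fun _ (fun s => is_deriveM (is_derive_cst _ _ _) (dprod s))).
rewrite /mxtrace -(eq_bigr _ (fun i _ => detB i)) exchange_big /=.
apply: eq_bigr => s _; rewrite /GRing.scale /= mulr0 addr0 big_distrr.
apply: eq_bigr => i _; rewrite [X in _ = _ * X](bigD1 i) //=; congr (_ * (_ * _)).
  by rewrite mxE eqxx.
by apply: eq_bigr => k ki; rewrite mxE (negbTE ki).
Qed.

End determinant_derivative.

(** * The Piola identity and the divergence *)

Section matrix_fields.
Variables (R : realType) (n m : nat) (U : set 'rV[R]_n) (A : 'rV[R]_n -> 'M[R]_m).
Hypothesis U_open : open U.
Hypothesis A_smooth : forall i j, smooth_on U (fun y => A y i j).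
Hypothesis A_unit : forall y, U y -> A y \in unitmx.

Definition partial_mx (a : 'I_n) (y : 'rV[R]_n) : 'M[R]_m :=
  \matrix_(i, j) partial a (fun z => A z i j) y.

Let det_neq0 y : U y -> \det (A y) != 0.
Proof. by move=> /A_unit; rewrite unitmxE unitfE. Qed.

(** Differentiate [invmx A *m A = 1]. *)
Lemma partial_invmx a y : U y ->
  \matrix_(i, j) partial a (fun z => invmx (A z) i j) y =
    - (invmx (A y) *m partial_mx a y *m invmx (A y)).
Proof.
move=> Uy; set dK := \matrix_(i, j) _.
have SK := smooth_on_invmx U_open A_unit A_smooth.
suff E : dK *m A y + invmx (A y) *m partial_mx a y = 0.
  rewrite -[dK](mulmxK (A_unit Uy)) -mulNmx; congr (_ *m _).
  by apply/eqP; rewrite -addr_eq0 E.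
apply/matrixP => i j; rewrite !mxE -big_split /=.
transitivity (partial a (fun z => \sum_k invmx (A z) i k * A z k j) y).
  have dK' k : derivable (fun z => invmx (A z) i k) y 'e_a.
    exact: smooth_on_derivable (SK i k) Uy.
  have dA' k : derivable (fun z => A z k j) y 'e_a.
    exact: smooth_on_derivable (A_smooth k j) Uy.
  rewrite partial_sum; last by move=> k; apply: derivableM.
  apply: eq_bigr => k _; rewrite !mxE partialM// addrC; congr (_ + _).
  exact: mulrC.
rewrite -[RHS](partial_cst a y ((i == j)%:R)); apply: (partial_eq_on a U_open Uy) => z Uz.
have /matrixP/(_ i j) := mulVmx (A_unit Uz).
by rewrite !mxE.
Qed.

(** Differentiating [`|det A| ^ 2 = det A ^ 2] shows that [`|det A|] has the same
    logarithmic derivative as [det A]. *)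
Lemma partial_abs_det a y : U y ->
  partial a (fun z => `|\det (A z)|) y =
    `|\det (A y)| * \tr (partial_mx a y *m invmx (A y)).
Proof.
move=> Uy.
have ddet : is_derive y 'e_a (fun z => \det (A z))
    (\tr (partial_mx a y *m \adj (A y))).
  apply: is_derive_det => i j; rewrite mxE.
  exact/derivableP/smooth_on_derivable/Uy.
have adjE : \adj (A y) = \det (A y) *: invmx (A y).
  by rewrite /invmx A_unit// scalerA divff ?scale1r// det_neq0.
have dabs : derivable (fun z => `|\det (A z)|) y 'e_a.
  apply: smooth_on_derivable Uy; apply: smooth_on_abs => //.
  exact: smooth_on_det.
set t := \tr _.
have sq : partial a (fun z => `|\det (A z)| * `|\det (A z)|) y =
          partial a (fun z => \det (A z) * \det (A z)) y.
  apply: (partial_eq_on a U_open Uy) => z _.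
  by rewrite -!expr2 real_normK// num_real.
have dd : partial a (fun z => \det (A z)) y = \det (A y) * t.
  by case: ddet => _; rewrite /partial => ->; rewrite adjE -scalemxAr mxtraceZ.
move: sq; rewrite partialM// partialM; [|by case: ddet|by case: ddet].
rewrite dd => sq.
have w0 : `|\det (A y)| != 0 by rewrite normr_eq0 det_neq0.
apply: (mulfI w0); rewrite mulrA -expr2 real_normK ?num_real//.
have half (x z : R) : x + x = z + z -> x = z by lra.
by rewrite (half _ _ sq) expr2 mulrA.
Qed.

End matrix_fields.

(** Both sides are triple sums of [K k a * H a i l * K l i], up to exchanging the
    roles of [a] and [i]; in the Piola identity [H a] is the derivative of the
    Jacobian matrix in direction [a]. *)
Lemma sum_trace_symmetric (R : comPzRingType) n (K : 'M[R]_n) (H : 'I_n -> 'M[R]_n) k :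
  (forall a i j, H a i j = H i a j) ->
  \sum_a K k a * \tr (H a *m K) = \sum_a (K *m H a *m K) k a.
Proof.
move=> HC.
transitivity (\sum_a \sum_i \sum_l K k a * (H a i l * K l i)).
  apply: eq_bigr => a _; rewrite /mxtrace big_distrr; apply: eq_bigr => i _.
  by rewrite mxE big_distrr.
rewrite exchange_big /=; apply: eq_bigr => a _.
rewrite mxE exchange_big /=; apply: eq_bigr => l _.
rewrite mxE big_distrl /=; apply: eq_bigr => i _.
by rewrite HC mulrA.
Qed.

Section piola.
Variables (R : realType) (n : nat) (U : set 'rV[R]_n) (phi : 'rV[R]_n -> 'rV[R]_n).
Hypothesis U_open : open U.
Hypothesis phi_smooth : forall j, smooth_on U (fun y => phi y ord0 j).

(** The Jacobian matrix through partial derivatives, whose entries are manifestly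
    smooth functions; it agrees with ['J] by [jacobian_partial]. *)
Definition jac (y : 'rV[R]_n) : 'M[R]_n :=
  \matrix_(i, j) partial i (fun z => phi z ord0 j) y.

Hypothesis jac_unit : forall y, U y -> jac y \in unitmx.

Lemma jac_smooth i j : smooth_on U (fun y => jac y i j).
Proof.
move=> k; apply: (Ck_on_eq U_open) (smooth_on_partial i (phi_smooth j) k) => y _.
by rewrite mxE.
Qed.

Lemma partial_jacC a i j y : U y ->
  partial a (fun z => jac z i j) y = partial i (fun z => jac z a j) y.
Proof.
move=> Uy.
have E (b c : 'I_n) : partial b (fun z => jac z c j) y =
    partial b (partial c (fun z => phi z ord0 j)) y.
  by apply: (partial_eq_on b U_open Uy) => z _; rewrite mxE.
by rewrite !E; exact: (partialC _ _ U_open Uy (phi_smooth j 2)).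
Qed.

Lemma abs_det_jac_smooth : smooth_on U (fun z => `|\det (jac z)|).
Proof.
apply: smooth_on_abs => //; last exact: smooth_on_det jac_smooth.
by move=> z Uz; have := jac_unit Uz; rewrite unitmxE unitfE.
Qed.

(** Up to a sign, [`|det J| J^-1] is the adjugate matrix of [J]; its rows are
    divergence free.  The derivatives of the determinant and of the inverse contribute
    opposite amounts, by the symmetry of the second derivatives of [phi]. *)
Lemma piola k y : U y ->
  \sum_a partial a (fun z => `|\det (jac z)| * invmx (jac z) k a) y = 0.
Proof.
move=> Uy.
have SK := smooth_on_invmx U_open jac_unit jac_smooth.
have Sw := abs_det_jac_smooth.
set K := invmx (jac y); set w := `|\det (jac y)|.
pose H a := partial_mx jac a y.
have HC a i j : H a i j = H i a j.
  by rewrite [LHS]mxE [RHS]mxE; exact: partial_jacC.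
transitivity (\sum_a w * (K k a * \tr (H a *m K) - (K *m H a *m K) k a)).
  apply: eq_bigr => a _.
  have dw : derivable (fun z => `|\det (jac z)|) y 'e_a.
    exact: smooth_on_derivable Sw Uy.
  rewrite [LHS]partialM//; last exact: smooth_on_derivable (SK k a) Uy.
  rewrite (partial_abs_det U_open jac_smooth jac_unit)//.
  have /matrixP/(_ k a) := partial_invmx U_open jac_smooth jac_unit a Uy.
  rewrite mxE [X in _ = X -> _]mxE => ->.
  by rewrite -/K -/(H a) -/w mulrBr mulrN mulrCA [LHS]addrC.
rewrite -mulr_sumr sumrB.
by rewrite (sum_trace_symmetric K k HC) subrr mulr0.
Qed.

(** The divergence of a vector density is natural.  By the product rule, [piola]
    removes the derivatives of the coefficients [`|det J| J^-1], and in the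
    remaining terms the chain rule cancels [J^-1] against [J]. *)
Lemma divergence_pullback (F : 'I_n -> 'rV[R]_n -> R) y : U y ->
  (forall k, differentiable (F k) (phi y)) ->
  \sum_a partial a (fun z => `|\det (jac z)| *
      \sum_k invmx (jac z) k a * F k (phi z)) y =
    `|\det (jac y)| * \sum_k partial k (F k) (phi y).
Proof.
move=> Uy dF.
have SK := smooth_on_invmx U_open jac_unit jac_smooth.
have Sw := abs_det_jac_smooth.
pose C k a z := `|\det (jac z)| * invmx (jac z) k a.
have dC k a b : derivable (C k a) y 'e_b.
  apply: derivableM; first exact: smooth_on_derivable Sw Uy.
  exact: smooth_on_derivable (SK k a) Uy.
have dphi : differentiable phi y.
  by apply: differentiable_row => j; exact: Ck_on1_differentiable Uy (phi_smooth j 1).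
have dFphi k b : derivable (F k \o phi) y 'e_b.
  by apply: diff_derivable; exact: differentiable_comp.
transitivity (\sum_a \sum_k (C k a y * \sum_l jac y a l * partial l (F k) (phi y)
    + F k (phi y) * partial a (C k a) y)).
  apply: eq_bigr => a _.
  transitivity (partial a (fun z => \sum_k C k a z * (F k \o phi) z) y).
    congr (partial a _ y); apply/funext => z; rewrite big_distrr /=.
    by apply: eq_bigr => k _; rewrite mulrA.
  rewrite partial_sum; last by move=> k; exact: derivableM.
  apply: eq_bigr => k _; rewrite partialM// partial_comp//.
  by congr (_ * _ + _); apply: eq_bigr => l _; rewrite mxE.
rewrite exchange_big /= big_distrr; apply: eq_bigr => k _ /=.
rewrite big_split /= -mulr_sumr piola// mulr0 addr0.
transitivity (`|\det (jac y)| *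
    \sum_l (invmx (jac y) *m jac y) k l * partial l (F k) (phi y)).
  under eq_bigr do rewrite -mulrA.
  rewrite -mulr_sumr; congr (_ * _).
  under eq_bigr do rewrite big_distrr /=.
  rewrite exchange_big /=; apply: eq_bigr => l _.
  by rewrite mxE big_distrl; apply: eq_bigr => a _; rewrite mulrA.
rewrite mulVmx ?jac_unit//; congr (_ * _); rewrite (bigD1 k)//= mxE eqxx mul1r.
by rewrite big1 ?addr0// => l lk; rewrite mxE eq_sym (negbTE lk) mul0r.
Qed.

End piola.

(** * The Laplacian under a change of coordinates *)

Section local_laplacian.
Variables (R : realType) (n : nat) (U : set 'rV[R]_n) (G : 'rV[R]_n -> 'M[R]_n).
Hypothesis U_open : open U.
Hypothesis G_smooth : forall i j, smooth_on U (fun y => G y i j).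
Hypothesis G_unit : forall y, U y -> G y \in unitmx.
Implicit Types (f : 'rV[R]_n -> R).

(** The gradient of [f] times the volume density: the vector density whose
    divergence defines the Laplacian. *)
Definition gradient_density f (i : 'I_n) (z : 'rV[R]_n) : R :=
  volume_density G z * \sum_(j < n) invmx (G z) i j * exterior_d f z ord0 j.

Lemma local_laplacianE f y :
  local_laplacian G f y =
    - (volume_density G y)^-1 * \sum_i partial i (gradient_density f i) y.
Proof. by []. Qed.

Lemma volume_density_gt0 y : U y -> 0 < volume_density G y.
Proof.
by move=> /G_unit; rewrite unitmxE unitfE => d0; rewrite sqrtr_gt0 normr_gt0.
Qed.

Lemma volume_density_smooth : smooth_on U (volume_density G).
Proof.
have d0 y : U y -> \det (G y) != 0 by move=> /G_unit; rewrite unitmxE unitfE.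
move=> k; apply: Ck_on_sqrt => //; first by move=> y Uy; rewrite normr_gt0 d0.
by apply: smooth_on_abs => //; exact: smooth_on_det.
Qed.

Lemma gradient_density_smooth f i : smooth_on U f ->
  smooth_on U (gradient_density f i).
Proof.
move=> Sf k; apply: (Ck_onM U_open (volume_density_smooth k)).
apply: (Ck_on_sum U_open) => j.
apply: (Ck_onM U_open (smooth_on_invmx U_open G_unit G_smooth i j k)).
by apply: (Ck_on_eq U_open) (smooth_on_partial j Sf k) => y _; rewrite mxE.
Qed.

Lemma local_laplacian_smooth f : smooth_on U f -> smooth_on U (local_laplacian G f).
Proof.
move=> Sf k.
have CV : Ck_on k U (fun y => -1 * (volume_density G y)^-1).
  apply: (Ck_onM U_open (Ck_on_cst U_open k _)).
  apply: (Ck_onV U_open _ (volume_density_smooth k)) => y Uy.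
  by rewrite gt_eqF// volume_density_gt0.
have CS : Ck_on k U (fun y => \sum_i partial i (gradient_density f i) y).
  apply: (Ck_on_sum U_open) => i.
  exact: (smooth_on_partial i (gradient_density_smooth i Sf) k).
apply: (Ck_on_eq U_open) (Ck_onM U_open CV CS) => y _.
by rewrite local_laplacianE mulN1r.
Qed.

Lemma local_laplacian_eq f1 f2 y : U y -> (forall z, U z -> f1 z = f2 z) ->
  local_laplacian G f1 y = local_laplacian G f2 y.
Proof.
move=> Uy f12.
have E : \sum_i partial i (gradient_density f1 i) y =
         \sum_i partial i (gradient_density f2 i) y.
  apply: eq_bigr => i _; apply: (partial_eq_on i U_open Uy) => z Uz.
  have e12 : exterior_d f1 z = exterior_d f2 z.
    by apply/rowP => j; rewrite !mxE; exact: (partial_eq_on j U_open Uz).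
  by rewrite /gradient_density e12.
exact: (congr1 (fun s => - (volume_density G y)^-1 * s) E).
Qed.

Lemma local_laplacian_linear (c : R) f1 f2 y : U y ->
  smooth_on U f1 -> smooth_on U f2 ->
  local_laplacian G (fun z => c * f1 z + f2 z) y =
    c * local_laplacian G f1 y + local_laplacian G f2 y.
Proof.
move=> Uy S1 S2; rewrite !local_laplacianE mulrCA -mulrDr; congr (_ * _).
rewrite mulr_sumr -big_split /=; apply: eq_bigr => i _.
have plin h1 h2 j z : smooth_on U h1 -> smooth_on U h2 -> U z ->
    partial j (fun z => c * h1 z + h2 z) z = c * partial j h1 z + partial j h2 z.
  move=> Sh1 Sh2 Uz; have dh1 := smooth_on_derivable (i := j) Sh1 Uz.
  have dc := derivable_cst c z 'e_j.
  apply: etrans (partialD (derivableM dc dh1) (smooth_on_derivable Sh2 Uz)) _.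
  by rewrite (@partialM _ _ j z (fun=> c) h1)// partial_cst mulr0 addr0.
rewrite -plin//; try exact: gradient_density_smooth.
apply: (partial_eq_on i U_open Uy) => z Uz; rewrite /gradient_density.
rewrite mulrCA -mulrDr; congr (_ * _).
rewrite mulr_sumr -big_split /=; apply: eq_bigr => j _.
by rewrite !mxE plin// mulrDr mulrCA.
Qed.

End local_laplacian.

Section change_of_coordinates.
Variables (R : realType) (n : nat) (U W : set 'rV[R]_n).
Variables (G H : 'rV[R]_n -> 'M[R]_n) (phi : 'rV[R]_n -> 'rV[R]_n).
Hypothesis U_open : open U.
Hypothesis W_open : open W.
Hypothesis phi_smooth : forall j, smooth_on U (fun y => phi y ord0 j).
Hypothesis phi_W : forall y, U y -> W (phi y).
Hypothesis H_smooth : forall i j, smooth_on W (fun y => H y i j).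
Hypothesis H_unit : forall y, W y -> H y \in unitmx.
Hypothesis G_unit : forall y, U y -> G y \in unitmx.
Hypothesis GH : forall y, U y ->
  G y = 'J phi y *m H (phi y) *m ('J phi y)^T.

Let phi_diff y : U y -> differentiable phi y.
Proof.
move=> Uy; apply: differentiable_row => j.
exact: Ck_on1_differentiable U_open Uy (phi_smooth j 1).
Qed.

Let GE y : U y -> G y = jac phi y *m H (phi y) *m (jac phi y)^T.
Proof. by move=> Uy; rewrite GH// (jacobian_partial (phi_diff Uy)). Qed.

Let jac_unit y : U y -> jac phi y \in unitmx.
Proof. by move=> Uy; have := G_unit Uy; rewrite GE// !unitmx_mul => /andP[/andP[]]. Qed.

Lemma volume_density_change y : U y ->
  volume_density G y = `|\det (jac phi y)| * volume_density H (phi y).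
Proof.
move=> Uy; rewrite /volume_density GE// !det_mulmx det_tr !normrM.
rewrite [X in Num.sqrt X]mulrAC -expr2 sqrtrM ?exprn_ge0//.
by rewrite sqrtr_sqr normr_id.
Qed.

Lemma gradient_density_change (f : 'rV[R]_n -> R) i y : smooth_on W f -> U y ->
  gradient_density G (f \o phi) i y =
    `|\det (jac phi y)| *
      \sum_k invmx (jac phi y) k i * gradient_density H f k (phi y).
Proof.
move=> Sf Uy; rewrite /gradient_density volume_density_change// -mulrA.
congr (_ * _).
(* In matrix form, with [J] the Jacobian: [G^-1 = J^-T H^-1 J^-1] and
   [d (f o phi) = J (df o phi)] as columns, so that one factor [J] cancels. *)
have Gi : invmx (G y) = (invmx (jac phi y))^T *m invmx (H (phi y)) *m invmx (jac phi y).
  set X := RHS.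
  suff GX : G y *m X = 1%:M by rewrite -[LHS]mulmx1 -GX mulKmx ?G_unit.
  rewrite GE// /X -!mulmxA (mulmxA (jac phi y)^T) -trmx_mul mulVmx ?jac_unit//.
  have Hu := H_unit (phi_W Uy).
  by rewrite trmx1 mul1mx mulKVmx// mulmxV ?jac_unit.
have df : (exterior_d (f \o phi) y)^T = jac phi y *m (exterior_d f (phi y))^T.
  apply/colP => j; rewrite !mxE partial_comp//; last first.
  - exact: Ck_on1_differentiable W_open (phi_W Uy) (Sf 1).
  - exact: phi_diff.
  by apply: eq_bigr => l _; rewrite !mxE.
transitivity (volume_density H (phi y) *
    (invmx (G y) *m (exterior_d (f \o phi) y)^T) i ord0).
  by congr (_ * _); rewrite [RHS]mxE; apply: eq_bigr => j _; rewrite [in RHS]mxE.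
rewrite df Gi -!mulmxA mulKmx ?jac_unit// [X in _ * X]mxE mulr_sumr.
apply: eq_bigr => k _; rewrite [X in _ * (X * _)]mxE mulrCA; congr (_ * (_ * _)).
by rewrite mxE; apply: eq_bigr => j _; rewrite [X in _ * X]mxE.
Qed.

(** The divergence of the gradient density is multiplied by [`|det J|], and so is the
    volume density by which it is divided. *)
Lemma local_laplacian_change (f : 'rV[R]_n -> R) y : smooth_on W f -> U y ->
  local_laplacian G (f \o phi) y = local_laplacian H f (phi y).
Proof.
move=> Sf Uy.
have E : \sum_i partial i (gradient_density G (f \o phi) i) y =
    `|\det (jac phi y)| * \sum_k partial k (gradient_density H f k) (phi y).
  rewrite -(divergence_pullback U_open phi_smooth jac_unit)//.
    apply: eq_bigr => i _; apply: (partial_eq_on i U_open Uy) => z Uz.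
    exact: gradient_density_change.
  move=> k; apply: (Ck_on1_differentiable W_open (phi_W Uy)).
  exact: gradient_density_smooth.
have d0 : `|\det (jac phi y)| != 0.
  by have := jac_unit Uy; rewrite unitmxE unitfE normr_eq0.
rewrite local_laplacianE E volume_density_change//.
rewrite mulrA; apply: (congr1 (fun s => s * _)).
by rewrite invfM -mulNr mulrAC mulNr mulVf// mulN1r.
Qed.

End change_of_coordinates.

(** * The Laplacian on the manifold *)

Section manifold_laplacian.
Variables (R : realType) (n : nat) (M : manifold R n) (g : pseudo_metric M).
Implicit Types (u : M -> R) (a b : atlas M).

Lemma chart_at_dom (x : M) : chart_dom (chart_at x) x.
Proof. by rewrite /chart_at; case: cid. Qed.

Lemma overlap_open a b : open (overlap a b).
Proof.
rewrite openE => y [ay by_]; apply: filterI.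
  by apply: open_nbhs_nbhs; split => //; exact: chart_img_open.
apply: (chart_inv_cont ay); apply: open_nbhs_nbhs; split => //.
exact: chart_dom_open.
Qed.

Lemma local_laplacian_chart u a b y : smooth u -> overlap a b y ->
  local_laplacian (g a) (u \o chart_inv a) y =
  local_laplacian (g b) (u \o chart_inv b) (transition a b y).
Proof.
move=> Su ab.
have oab : open (overlap a b) by exact: overlap_open.
have gu (c : atlas M) z : chart_img c z -> g c z \in unitmx.
  exact: metric_nondegenerate.
have gs := @metric_smooth _ _ _ g b.
have phiW z : overlap a b z -> chart_img b (transition a b z).
  by move=> [az bz]; exact: chart_map_img.
have gau z : overlap a b z -> g a z \in unitmx by move=> [/gu].
rewrite -(local_laplacian_change oab (@chart_img_open _ _ _ b) (@atlas_smooth _ _ M a b)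
  phiW gs (gu b) gau (@metric_change _ _ _ g a b) (Su b) ab).
apply: (local_laplacian_eq _ oab ab) => z [az bz] /=.
by rewrite /transition /= chart_mapK.
Qed.

(** The Laplacian may be computed in any chart, not only in the preferred chart of
    each point. *)
Lemma laplacian_chart u a y : smooth u -> chart_img a y ->
  laplacian g u (chart_inv a y) = local_laplacian (g a) (u \o chart_inv a) y.
Proof.
move=> Su ay; rewrite (local_laplacian_chart (b := chart_at (chart_inv a y)) Su)//.
by split=> //; exact: chart_at_dom.
Qed.

Lemma laplacian_smooth u : smooth u -> smooth (laplacian g u).
Proof.
move=> Su a k; apply: (Ck_on_eq (@chart_img_open _ _ _ a)) (_ : Ck_on k _
  (local_laplacian (g a) (u \o chart_inv a))).
  by move=> y ay; rewrite -laplacian_chart.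
apply: (local_laplacian_smooth (@chart_img_open _ _ _ a)) => //.
- exact: metric_smooth.
- exact: metric_nondegenerate.
Qed.

Lemma smooth_linear_subspace : linear_subspace [set u : M -> R | smooth u].
Proof.
split=> [a k|c u v Su Sv a k]; have oa := @chart_img_open _ _ _ a.
  exact: (Ck_on_cst oa k 0).
exact: (Ck_onD oa (Ck_onM oa (Ck_on_cst oa k c) (Su a k)) (Sv a k)).
Qed.

Lemma laplacian_linear (c : R) u v : smooth u -> smooth v ->
  laplacian g (c *: u + v) = c *: laplacian g u + laplacian g v.
Proof.
move=> Su Sv; apply/funext => x.
have cx := chart_map_img (chart_at_dom x).
exact: (local_laplacian_linear (@chart_img_open _ _ _ _) (@metric_smooth _ _ _ g _)
  (@metric_nondegenerate _ _ _ g _) c cx (Su _) (Sv _)).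
Qed.

(** The trace of [lambda *: g] with respect to [g] is [n * lambda]. *)
Lemma scal_einstein : einstein g -> exists s : R, forall x, scal g x = s.
Proof.
move=> [lambda ein]; exists (n%:R * lambda) => x; rewrite /scal.
set a := chart_at x; set y := chart_map _ x.
have ay : chart_img a y by exact: chart_map_img (chart_at_dom x).
rewrite /scalar_curvature.
transitivity (\sum_i (invmx (g a y) *m (lambda *: (g a y)^T)) i i).
  apply: eq_bigr => i _; rewrite mxE; apply: eq_bigr => j _.
  by rewrite ein// !mxE.
rewrite metric_sym// -scalemxAr mulVmx ?metric_nondegenerate//.
transitivity (\sum_(i < n) lambda).
  by apply: eq_bigr => i _; rewrite !mxE eqxx mulr1.
by rewrite sumr_const card_ord mulr_natl.
Qed.

End manifold_laplacian.

(** The shifts of the factors of [gjms] are those of [Y_eigenspace] once the constant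
    of the conformal Laplacian is added. *)
Lemma c_coefE (R : realType) (n i : nat) : (3 <= n)%N ->
  c_coef R n i = n%:R * (n%:R - 2) / (4 * n%:R * (n%:R - 1)) + b_coef R n i.
Proof.
move=> hn; rewrite /c_coef /b_coef.
have n0 : n%:R != 0 :> R by rewrite pnatr_eq0 -lt0n (leq_trans _ hn).
have n1 : n%:R - 1 != 0 :> R by rewrite subr_eq0 pnatr_eq1 gtn_eqF// (leq_trans _ hn).
by field; rewrite n0 n1.
Qed.

(** The difference [i (1 - i) - j (1 - j)] factors as [(i - j) (1 - (i + j))], whose
    second factor is negative for positive [i] and [j]. *)
Lemma b_coef_inj (R : realType) (n i j : nat) : (3 <= n)%N -> (0 < i)%N -> (0 < j)%N ->
  b_coef R n i = b_coef R n j -> i = j.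
Proof.
move=> hn i0 j0; rewrite /b_coef => /mulIf.
have n0 : n%:R != 0 :> R by rewrite pnatr_eq0 -lt0n (leq_trans _ hn).
have n1 : n%:R - 1 != 0 :> R by rewrite subr_eq0 pnatr_eq1 gtn_eqF// (leq_trans _ hn).
rewrite invr_neq0 ?mulf_neq0// => /(_ isT) ij.
have : (i%:R - j%:R) * (1 - (i%:R + j%:R)) = i%:R * (1 - i%:R) - j%:R * (1 - j%:R) :> R.
  by ring.
rewrite ij subrr => /eqP; rewrite mulf_eq0 => /orP[|].
  by rewrite subr_eq0 eqr_nat => /eqP.
rewrite subr_eq0 -natrD eq_sym pnatr_eq1 => /eqP.
by case: i j i0 j0 {ij} => [|i] [|j]//; rewrite addSn addnS.
Qed.

Theorem theorem5p2 (R : realType) (n : nat) (hn : (3 <= n)%N)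
  (M : manifold R n) (g : pseudo_metric M)
  (g_einstein : einstein g) (scal_neq0 : forall x : M, scal g x != 0)
  (k : nat) (hk : (0 < k)%N) :
  internal_direct_sum (null_space (M := M) (gjms g k))
    (fun i : 'I_k => Y_eigenspace g i.+1).
Proof.
have [s s_neq0 sE] : exists2 s : R, s != 0 & forall x, scal g x = s.
  have [s sE] := scal_einstein g_einstein.
  (* On an empty manifold any nonzero number serves as the scalar curvature. *)
  have [[x _]|noM] := pselect (exists x : M, True).
    by exists s => //; rewrite -(sE x).
  by exists 1 => [|x]; [exact: oner_neq0|case: noM; exists x].
pose S := [set u : M -> R | smooth u].
pose c i := c_coef R n i * s.
have c_inj i j : (0 < i)%N -> (0 < j)%N -> c i = c j -> i = j.
  move=> i0 j0 /(mulIf s_neq0); rewrite !c_coefE// => /addrI.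
  exact: b_coef_inj.
have gjmsE : gjms g k = shifted_product (laplacian g) c k.
  apply: eq_bigr => i _; apply/funext => u; apply/funext => x.
  by rewrite /gjms_factor sE.
have YE (i : 'I_k) : Y_eigenspace g i.+1 = eigenspace_on S (laplacian g) (c i.+1).
  rewrite /Y_eigenspace /eigenspace_on predeqE => u; split=> -[Su eu]; split=> //.
    apply/funext => x; have := eu x.
    rewrite /conformal_laplacian sE => /(canRL (addrK _)) ->.
    by rewrite /c c_coefE// -[RHS]/(- _ * u x); ring.
  move=> x; rewrite /conformal_laplacian eu sE -[(_ *: _) x]/(- c i.+1 * u x).
  by rewrite /c c_coefE//; ring.
have NE : null_space (M := M) (gjms g k) =
    kernel_on S (shifted_product (laplacian g) c k).
  rewrite gjmsE predeqE => u; split=> -[Su Pu]; split=> //; first exact/funext.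
  by move=> x; rewrite Pu.
have YsE : (fun i : 'I_k => Y_eigenspace g i.+1) =
    (fun i => eigenspace_on S (laplacian g) (c i.+1)) by exact/funext.
rewrite NE YsE.
exact: (shifted_product_decomposition (smooth_linear_subspace M)
  (@laplacian_smooth _ _ _ g) (@laplacian_linear _ _ _ g) k c_inj).
Qed.
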